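(* For real $s>2$, dimension $3$ is the minimal dimension in which the monotone-weight reverse trace inequality \[ \operatorname{Tr} f(A)A^sB^s\geq\operatorname{Tr} f(A)(A^{1/2}BA^{1/2})^s \] can fail. More precisely, this inequality holds for all positive semidefinite $A,B\in M_2(\mathbb C)$ and all nonnegative nondecreasing functions $f$ on an interval containing $\operatorname{spec}(A)$, while for every $s>2$ there exist positive definite $A,B\in M_3(\mathbb C)$ and a nonnegative nondecreasing function $f$ on an interval containing $\operatorname{spec}(A)$ for which the inequality is strictly reversed.
   Context: Powers and functions of Hermitian matrices are taken by the functional calculus; $\operatorname{spec}(A)$ is the set of eigenvalues of $A$. *)

(* Defs.v *)
From mathcomp Require Import all_boot all_order all_algebra.
From mathcomp Require Import all_classical all_reals exp.
From mathcomp Require Import spectral complex.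

Set Implicit Arguments.
Unset Strict Implicit.
Unset Printing Implicit Defensive.

Import Order.TTheory GRing.Theory Num.Theory.

Local Open Scope ring_scope.
Local Open Scope sesquilinear_scope.
Local Open Scope complex_scope.

(* The order of R[i] makes 0 <= z and 0 < z include that z is real. *)
Definition psdmx (R : realType) (n : nat) (A : 'M[R[i]]_n) : Prop :=
  A \is hermsymmx /\
  forall v : 'cV[R[i]]_n, 0 <= (v^t* *m A *m v) ord0 ord0.

Definition pdmx (R : realType) (n : nat) (A : 'M[R[i]]_n) : Prop :=
  A \is hermsymmx /\
  forall v : 'cV[R[i]]_n, v != 0 -> 0 < (v^t* *m A *m v) ord0 ord0.

Definition spec (R : realType) (n : nat) (A : 'M[R[i]]_n) : set R[i] :=
  [set a | eigenvalue A a].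

(* Meaningful for Hermitian A: then A = P^-1 *m diag_mx d *m P with
   P = spectralmx A unitary and d = spectral_diag A real (see
   hermitian_spectral_diag_real), so taking real parts loses nothing.
   By funcalc_diag the result is the same for every diagonalization of A. *)
Definition funcalc (R : realType) (n : nat) (f : R -> R) (A : 'M[R[i]]_n) :
    'M[R[i]]_n :=
  invmx (spectralmx A) *m
  diag_mx (map_mx (fun z : R[i] => (f (complex.Re z))%:C) (spectral_diag A)) *m
  spectralmx A.

Definition mxpowR (R : realType) (n : nat) (A : 'M[R[i]]_n) (s : R) :
    'M[R[i]]_n :=
  funcalc (fun x => powR x s) A.

(* Functions on an interval I are represented by total functions R -> R of
   which only the values on I matter. *)
Definition nonneg_nondecr_on (R : realType) (I : interval R) (f : R -> R) :
    Prop :=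
  {in I, forall x, 0 <= f x} /\ {in I &, {homo f : x y / x <= y}}.

Definition spec_in (R : realType) (n : nat) (A : 'M[R[i]]_n) (I : interval R) :
    Prop :=
  (spec A `<=` [set x%:C | x in [set` I]])%classic.

Definition trace_split (R : realType) (n : nat) (s : R) (f : R -> R)
    (A B : 'M[R[i]]_n) : R[i] :=
  \tr (funcalc f A *m mxpowR A s *m mxpowR B s).

Definition trace_joint (R : realType) (n : nat) (s : R) (f : R -> R)
    (A B : 'M[R[i]]_n) : R[i] :=
  \tr (funcalc f A *m mxpowR (mxpowR A 2^-1 *m B *m mxpowR A 2^-1) s).

Lemma funcalc_diag (R : realType) (n : nat) (f : R -> R) (A P : 'M[R[i]]_n)
    (d : 'rV[R]_n) :
  A \is hermsymmx -> P \in unitmx ->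
  A = invmx P *m diag_mx (map_mx (fun x => x%:C) d) *m P ->
  funcalc f A = invmx P *m diag_mx (map_mx (fun x => (f x)%:C) d) *m P.
Proof.
move=> Aherm uP eA.
have uQ := spectral_unit A.
have eQ : A = invmx (spectralmx A) *m diag_mx (spectral_diag A) *m spectralmx A.
  exact/orthomx_spectralP/hermitian_normalmx.
rewrite /funcalc; set Q := spectralmx A in uQ eQ *.
set e := spectral_diag A in eQ *.
pose M := Q *m invmx P.
have eM : diag_mx e *m M = M *m diag_mx (map_mx (fun x => x%:C) d).
  apply: (can_inj (mulKmx (_ : invmx Q \in unitmx))); first by rewrite unitmx_inv.
  apply: (can_inj (mulmxK uP)).
  rewrite /M !mulmxA mulVmx // mul1mx mulmxKV //.
  by rewrite -eA.
have {}eM : diag_mx (map_mx (fun z : R[i] => (f (complex.Re z))%:C) e) *m M =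
    M *m diag_mx (map_mx (fun x => (f x)%:C) d).
  apply/matrixP => i j; have /matrixP/(_ i j) := eM.
  rewrite !mul_diag_mx !mul_mx_diag !mxE.
  set m := (\sum_k _) => h.
  have [->|m0] := eqVneq m 0; first by rewrite mulr0 mul0r.
  suff -> : e ord0 i = (d ord0 j)%:C by rewrite mulrC.
  by apply: (mulIf m0); rewrite h mulrC.
have eP : invmx P = invmx Q *m M by rewrite /M mulKmx.
have eQM : Q = M *m P by rewrite /M mulmxKV.
rewrite eP {2}eQM mulmxA -(mulmxA (invmx Q)) eM !mulmxA.
by [].
Qed.

(* Main.v *)
Require Import Defs.
From mathcomp Require Import all_boot all_order all_algebra.
From mathcomp Require Import all_classical all_reals exp.
From mathcomp Require Import spectral complex.
From mathcomp Require Import topology normedtype sequences derive realfun.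
From mathcomp Require Import ring lra.
Import Order.TTheory GRing.Theory Num.Theory.
Import numFieldNormedType.Exports.
Local Open Scope ring_scope.
Local Open Scope sesquilinear_scope.
Local Open Scope complex_scope.

Set Implicit Arguments.
Unset Strict Implicit.
Unset Printing Implicit Defensive.

(* Diagonalize A = diag(d) and put X = A^(1/2) B A^(1/2).

   Dimension 2: for two nonnegative numbers with fixed product the sum of
   their s-th powers is a convex function of their sum (with product e^(2p)
   it is x = cosh y |-> cosh (s y) up to scaling, and the slope
   s sinh (s y) / sinh y increases with y). The trace and the determinant of X
   express its eigenvalue pair through the pairs of products of eigenvalues of
   A and B, which gives the Araki-Lieb-Thirring inequality
   Tr X^s <= Tr A^s B^s. Applying it also to A^-1 and X, which have
   B = A^(-1/2) X A^(-1/2), one gets (X^s)_11 <= (A^s B^s)_11 for the larger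
   eigenvalue of A. A nondecreasing weight is a nonnegative combination of
   these two inequalities.

   Dimension 3: take f to be the indicator of the top eigenvalue 1 of A, with
   eigenvector e_1. Let e_1 be orthogonal to the top eigenvector of B, the other
   two eigenvalues of B being 3 and 1, so that (B^s)_11 <= 3^s. The remaining
   data are tuned so that X has an explicit eigenvector of squared norm less
   than 200 Y^2, with first coordinate 1 and eigenvalue at least 3 Y, whence
   (X^s)_11 > 3^s Y^(s-2) / 200, and s > 2 lets Y absorb the constant. *)

(** * Sums of powers of two numbers with a given product *)

Section MonotoneDerivative.
Local Open Scope classical_set_scope.

Lemma le_of_derive_ge0 (R : realType) (f df : R -> R) (x y : R) :
  (forall t : R, x <= t <= y -> is_derive t 1 f (df t)) ->
  (forall t : R, x < t < y -> 0 <= df t) -> x <= y -> f x <= f y.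
Proof.
move=> fdf df0; rewrite le_eqVlt => /predU1P[->//|xy].
have cf : {within `[x, y], continuous f}.
  apply: continuous_in_subspaceT => t; rewrite inE /= in_itv /= => /fdf dft.
  by apply/differentiable_continuous/derivable1_diffP; case: dft.
have [c] : exists2 c, c \in `]x, y[%R & f y - f x = df c * (y - x).
  apply: MVT => //.
  by move=> t; rewrite in_itv /= => /andP[xt ty]; apply: fdf; rewrite !ltW.
rewrite in_itv /= => /df0 dfc E.
by rewrite -subr_ge0 E mulr_ge0 // subr_ge0 ltW.
Qed.

End MonotoneDerivative.

Section Hyperbolic.
Variable R : realType.
Implicit Types (s x y : R).

Definition sinhR x : R := (expR x - expR (- x)) / 2.
Definition coshR x : R := (expR x + expR (- x)) / 2.

#[local] Instance is_derive_sinhR s x :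
  is_derive x 1 (fun y => sinhR (s * y)) (s * coshR (s * x)).
Proof.
rewrite /sinhR /coshR; apply: is_derive_eq.
by rewrite !scaler1 /GRing.scale/=; ring.
Qed.

#[local] Instance is_derive_coshR s x :
  is_derive x 1 (fun y => coshR (s * y)) (s * sinhR (s * x)).
Proof.
rewrite /sinhR /coshR; apply: is_derive_eq.
by rewrite !scaler1 /GRing.scale/=; ring.
Qed.

#[local] Instance is_derive_sinhR1 x : is_derive x 1 sinhR (coshR x).
Proof.
have := is_derive_sinhR 1 x; rewrite !mul1r.
by congr is_derive; apply/funext => y; rewrite mul1r.
Qed.

#[local] Instance is_derive_coshR1 x : is_derive x 1 coshR (sinhR x).
Proof.
have := is_derive_coshR 1 x; rewrite !mul1r.
by congr is_derive; apply/funext => y; rewrite mul1r.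
Qed.

Lemma sinhR_ge0 x : 0 <= x -> 0 <= sinhR x.
Proof.
by move=> x0; rewrite divr_ge0 // subr_ge0 ler_expR; lra.
Qed.

Lemma sinhR_gt0 x : 0 < x -> 0 < sinhR x.
Proof.
by move=> x0; rewrite divr_gt0 // subr_gt0 ltr_expR; lra.
Qed.

Lemma coshRN x : coshR (- x) = coshR x.
Proof. by rewrite /coshR opprK addrC. Qed.

(** The difference of the two sides vanishes at 0 and has derivative
    [(s ^+ 2 - 1) * (sinhR (s * y) * sinhR y)], since its cosh-cosh terms cancel. It is the
    numerator of the derivative of [sinhR (s * t) / sinhR t]. *)
Lemma sinhR_coshR_le s x : 1 <= s -> 0 <= x ->
  sinhR (s * x) * coshR x <= s * coshR (s * x) * sinhR x.
Proof.
move=> s1 x0; rewrite -subr_ge0.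
pose f y := s * coshR (s * y) * sinhR y - sinhR (s * y) * coshR y.
have f0 : f 0 = 0 by rewrite /f mulr0 /sinhR /coshR oppr0 expR0; ring.
rewrite -[leLHS]f0 -/(f x).
pose df y := (s ^+ 2 - 1) * (sinhR (s * y) * sinhR y).
apply: (@le_of_derive_ge0 _ f df) => //.
- move=> t _; rewrite /f /df; apply: is_derive_eq.
  by rewrite /GRing.scale/=; ring.
- move=> t /andP[/ltW t0 _]; rewrite /df mulr_ge0 //; first nra.
  by rewrite mulr_ge0 ?sinhR_ge0 ?mulr_ge0 // (le_trans ler01).
Qed.

(** Monotonicity of [sinhR (s * t) / sinhR t], cross-multiplied. *)
Lemma sinhR_ratio_homo s x y : 1 <= s -> 0 < x -> x <= y ->
  sinhR (s * x) * sinhR y <= sinhR (s * y) * sinhR x.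
Proof.
move=> s1 x0 xy; have y0 := lt_le_trans x0 xy.
pose f t := sinhR (s * t) / sinhR t.
pose df t := (s * coshR (s * t) * sinhR t - sinhR (s * t) * coshR t) /
  sinhR t ^+ 2.
suff : f x <= f y.
  by rewrite /f ler_pdivrMr ?sinhR_gt0 // mulrAC ler_pdivlMr ?sinhR_gt0.
apply: (@le_of_derive_ge0 _ f df) xy.
- move=> t /andP[xt _]; have st : sinhR t != 0.
    by rewrite gt_eqF // sinhR_gt0 // (lt_le_trans x0).
  rewrite /f /df; apply: is_derive_eq.
  by rewrite /GRing.scale/=; field.
- move=> t /andP[xt _]; rewrite /df divr_ge0 ?exprn_even_ge0 // subr_ge0.
  by rewrite sinhR_coshR_le // ltW // (lt_trans x0).
Qed.

(** Convexity of cosh (s x) as a function of cosh x, in the form of its tangent at cosh y. The gap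
    between function and tangent has its minimum over x >= 0 at y, because the slope ratio is
    monotone. *)
Lemma coshR_tangent s x y : 1 <= s -> 0 < y ->
  s * sinhR (s * y) / sinhR y * (coshR x - coshR y) <=
  coshR (s * x) - coshR (s * y).
Proof.
move=> s1 y0.
(* Both sides are even in [x]. *)
wlog x0 : x / 0 <= x.
  move=> W; have [/W//|x0] := leP 0 x.
  by have := W (- x); rewrite mulrN !coshRN; apply; rewrite oppr_ge0 ltW.
set c := s * sinhR (s * y) / sinhR y.
pose f t := coshR (s * t) - c * coshR t.
pose df t := s * sinhR (s * t) - c * sinhR t.
have fdf (t : R) : is_derive t 1 f (df t).
  by rewrite /f /df; apply: is_derive_eq; rewrite /GRing.scale/=; ring.
suff : f y <= f x by rewrite /f; lra.
have cs0 : 0 < s / sinhR y by rewrite divr_gt0 ?sinhR_gt0 //; lra.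
have dfE t : df t =
    s / sinhR y * (sinhR (s * t) * sinhR y - sinhR (s * y) * sinhR t).
  by rewrite /df /c; field; rewrite gt_eqF // sinhR_gt0.
(* [f] increases to the right of [y] and decreases on its left. *)
have [yx|/ltW xy] := leP y x.
  apply: (@le_of_derive_ge0 _ f df _ _ (fun t _ => fdf t) _ yx).
  move=> t /andP[yt _]; rewrite dfE pmulr_rge0 // subr_ge0.
  by rewrite sinhR_ratio_homo // ltW.
rewrite -lerN2; apply: (@le_of_derive_ge0 _ (fun t => - f t)
  (fun t => - df t) _ _ (fun t _ => is_deriveN (fdf t)) _ xy).
move=> t /andP[xt ty]; rewrite oppr_ge0 dfE pmulr_rle0 // subr_le0.
by rewrite sinhR_ratio_homo // ?ltW // (le_lt_trans x0).
Qed.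
End Hyperbolic.

Section PowerSums.
Variable R : realType.
Implicit Types (s x m : R).

(** Young's inequality for [m] and [powR x (s - 1)], with conjugate exponents s and s / (s - 1). *)
Lemma powR_tangent s x m : 1 < s -> 0 < x -> 0 <= m ->
  s * powR x (s - 1) * (m - x) <= powR m s - powR x s.
Proof.
move=> s1 x0 m0; have s0 : 0 < s by lra.
have q0 : 0 < s / (s - 1) by rewrite divr_gt0 ?subr_gt0.
have pq : s^-1 + (s / (s - 1))^-1 = 1 by field; rewrite !gt_eqF //; lra.
have := conjugate_powR m0 (powR_ge0 x (s - 1)) s0 q0 pq.
rewrite -powRrM (_ : (s - 1) * _ = s); last by field; rewrite gt_eqF; lra.
have := mulr_powRB1 (ltW x0) s0.
set a := powR x (s - 1); set b := powR x s; set c := powR m s => E H.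
rewrite -(ler_pM2l s0) in H.
have : s * (c / s + b / (s / (s - 1))) = c + (s - 1) * b.
  by field; rewrite !gt_eqF //; lra.
by move=> E2; rewrite E2 in H; nra.
Qed.

(** The number [c] is the slope of a supporting line, at [x1 + x2], of the power sum viewed as a
    function of the sum of a pair with fixed product. *)
Lemma powR_sum_tangent s x1 x2 : 1 < s -> 0 <= x1 -> 0 <= x2 ->
  exists c : R, forall m1 m2, 0 <= m1 -> 0 <= m2 -> m1 * m2 = x1 * x2 ->
    c * (m1 + m2 - (x1 + x2)) <=
    powR m1 s + powR m2 s - (powR x1 s + powR x2 s).
Proof.
move=> s1 + +; have s0 : s != 0 by rewrite gt_eqF //; lra.
wlog : x1 x2 / x2 <= x1 => [W x10 x20|].
  have /orP[/W|/W W'] := le_total x2 x1; first exact.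
  have [c cP] := W' x20 x10; exists c => m1 m2 m10 m20 e.
  by rewrite (addrC x1) (addrC (powR x1 s)); apply: cP; rewrite // e mulrC.
(* For a double point the hyperbolic slope would be 0 / 0. Slope 0 works: by the inequality of
   arithmetic and geometric means, the equal pair minimizes the power sum. *)
rewrite le_eqVlt => /predU1P[->|x21] x10.
  move=> _; exists 0 => m1 m2 m10 m20 e; rewrite mul0r.
  have := powRM s m10 m20; rewrite e powRM //.
  have := powR_ge0 m1 s; have := powR_ge0 m2 s; have := powR_ge0 x1 s.
  set a := powR m1 s; set b := powR m2 s; set c := powR x1 s => c0 b0 a0 E.
  have : (c + c) ^+ 2 <= (a + b) ^+ 2.
    by rewrite -subr_ge0; have := sqr_ge0 (a - b); lra.
  by rewrite subr_ge0 ler_sqr // nnegrE addr_ge0.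
have {}x10 := le_lt_trans _ x21.
(* If [x2] is 0, the zero product forces one of [m1], [m2] to vanish, and the tangent of a single
   power suffices. *)
rewrite le_eqVlt => /predU1P[x20|x20].
  have x1p : 0 < x1 by rewrite x20.
  exists (s * powR x1 (s - 1)) => m1 m2 m10 m20.
  rewrite -x20 mulr0 => /eqP; rewrite mulf_eq0 powR0 // !addr0.
  by case/orP=> /eqP ->; rewrite powR0 // ?add0r ?addr0; apply: powR_tangent.
have x1p := lt_trans x20 x21.
(* Logarithmic coordinates: x1 = e^(p + y) and x2 = e^(p - y), where [p] depends only on the
   product. *)
pose p := (ln x1 + ln x2) / 2; pose y := (ln x1 - ln x2) / 2.
have y0 : 0 < y by rewrite divr_gt0 // subr_gt0 ltr_ln ?posrE.
(* The slope in cosh y is rescaled because the sum is 2 e^p cosh y and the power sum is 2 e^(s p)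
   cosh (s y). *)
exists (s * sinhR (s * y) / sinhR y * expR (s * p) / expR p) => m1 m2 m10 m20 e.
have : m1 * m2 != 0 by rewrite e mulf_neq0 ?gt_eqF.
rewrite mulf_eq0 negb_or => /andP[/negPf m1n /negPf m2n].
have {}m10 : 0 < m1 by rewrite lt_neqAle eq_sym m1n.
have {}m20 : 0 < m2 by rewrite lt_neqAle eq_sym m2n.
pose a := (ln m1 - ln m2) / 2.
have ep : (ln m1 + ln m2) / 2 = p.
  by rewrite /p -!lnM ?posrE // e.
have E (u v : R) r : 0 < u -> 0 < v ->
    powR u r + powR v r =
    2 * expR (r * ((ln u + ln v) / 2)) * coshR (r * ((ln u - ln v) / 2)).
  move=> u0 v0; rewrite /powR !gt_eqF // /coshR.
  have -> : forall e f g : R, 2 * e * ((f + g) / 2) = e * f + e * g.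
    by move=> e0 f g; field.
  by rewrite -!expRD; congr (expR _ + expR _); field.
have E1 (u v : R) : 0 < u -> 0 < v ->
    u + v = 2 * expR ((ln u + ln v) / 2) * coshR ((ln u - ln v) / 2).
  move=> u0 v0; have := E u v 1 u0 v0.
  by rewrite !powRr1 ?(ltW u0) ?(ltW v0) // !mul1r.
rewrite (E m1 m2 s m10 m20) (E x1 x2 s x1p x20) (E1 m1 m2 m10 m20).
rewrite (E1 x1 x2 x1p x20) ep -/p -/y -/a.
have := coshR_tangent a (ltW s1) y0.
set c := s * sinhR (s * y) / sinhR y; set C1 := coshR a; set C2 := coshR y.
set D1 := coshR _; set D2 := coshR _ => H.
rewrite -!mulrBr -subr_ge0.
have := expR_gt0 (s * p); have := expR_gt0 p.
set e1 := expR p; set e2 := expR _ => e10 e20.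
rewrite (_ : _ - _ = 2 * e2 * (D1 - D2 - c * (C1 - C2))); last first.
  by field; rewrite gt_eqF.
by rewrite !mulr_ge0 ?subr_ge0 // ltW.
Qed.

(** The tangent inequalities for the two pairs, averaged with weights [l] and [1 - l]: the linear
    terms cancel. *)
Lemma powR_sum_convex s x1 x2 m1 m2 n1 n2 (l : R) : 1 < s ->
  0 <= x1 -> 0 <= x2 -> 0 <= m1 -> 0 <= m2 -> 0 <= n1 -> 0 <= n2 ->
  0 <= l <= 1 -> m1 * m2 = x1 * x2 -> n1 * n2 = x1 * x2 ->
  x1 + x2 = l * (m1 + m2) + (1 - l) * (n1 + n2) ->
  powR x1 s + powR x2 s <=
  l * (powR m1 s + powR m2 s) + (1 - l) * (powR n1 s + powR n2 s).
Proof.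
move=> s1 x10 x20 m10 m20 n10 n20 /andP[l0 l1] em en E.
have [c cP] := powR_sum_tangent s1 x10 x20.
have Hm := cP _ _ m10 m20 em; have Hn := cP _ _ n10 n20 en.
have l1' : 0 <= 1 - l by lra.
have := lerD (ler_wpM2l l0 Hm) (ler_wpM2l l1' Hn).
rewrite E; set X := powR x1 s + _; set M := powR m1 s + _.
set N := powR n1 s + _; set m := m1 + m2; set n := n1 + n2.
by move=> H; lra.
Qed.
End PowerSums.

(** * Functional calculus in an eigenbasis *)

(* A copy of [^t*] typed over [R[i]] itself, so that all products elaborate to
   the same ring structure. *)
Definition adjmx (R : realType) m n (M : 'M[R[i]]_(m, n)) : 'M[R[i]]_(n, m) :=
  M^t*.

Definition rdiag (R : realType) n (d : 'rV[R]_n) : 'M[R[i]]_n :=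
  diag_mx (map_mx (fun x : R => x%:C) d).

Definition sqmod (R : realType) (z : R[i]) : R :=
  complex.Re z ^+ 2 + complex.Im z ^+ 2.

Section Adjoint.
Variable R : realType.

Lemma adjmxE m n (M : 'M[R[i]]_(m, n)) i j : adjmx M i j = (M j i)^*.
Proof. by rewrite !mxE. Qed.

Lemma adjmxK m n : cancel (@adjmx R m n) (@adjmx R n m).
Proof. by move=> M; apply/matrixP => i j; rewrite !adjmxE conjcK. Qed.

Lemma adjmx_mul m n p (A : 'M[R[i]]_(m, n)) (B : 'M[R[i]]_(n, p)) :
  adjmx (A *m B) = adjmx B *m adjmx A.
Proof. by rewrite /adjmx trmx_mul map_mxM. Qed.

Lemma adjmx_rdiag n (d : 'rV[R]_n) : adjmx (rdiag d) = rdiag d.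
Proof.
by apply/matrixP => i j; rewrite adjmxE !mxE eq_sym; case: eqP => [->|_];
  rewrite ?mulr1n ?mulr0n ?conjc_real ?conjc0.
Qed.

Lemma hermsymmxP n (A : 'M[R[i]]_n) : reflect (adjmx A = A) (A \is hermsymmx).
Proof.
by rewrite is_hermitianmxE expr0 scale1r; apply: (iffP eqP) => /esym.
Qed.

Lemma sqmod_ge0 (z : R[i]) : 0 <= sqmod z.
Proof. by rewrite addr_ge0 ?sqr_ge0. Qed.

Lemma sqmodE (z : R[i]) : (sqmod z)%:C = z^* * z.
Proof. by case: z => a b; simpc; congr (_ +i* _); rewrite /sqmod /=; ring. Qed.

Variable n : nat.
Implicit Types (A B M U : 'M[R[i]]_n) (d e : 'rV[R]_n) (f g : R -> R).

Lemma rdiagE d i j : rdiag d i j = (d ord0 i)%:C *+ (i == j).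
Proof. by rewrite !mxE. Qed.

Lemma rdiag_mul d e : rdiag d *m rdiag e = rdiag (\row_i (d ord0 i * e ord0 i)).
Proof.
rewrite /rdiag mulmx_diag; congr diag_mx; apply/rowP => i.
by rewrite !mxE rmorphM.
Qed.

Lemma herm_diagonalized U d : adjmx U *m rdiag d *m U \is hermsymmx.
Proof.
by apply/hermsymmxP; rewrite !adjmx_mul adjmxK adjmx_rdiag mulmxA.
Qed.

Lemma funcalc_diagonalized f U d : U *m adjmx U = 1%:M ->
  funcalc f (adjmx U *m rdiag d *m U) = adjmx U *m rdiag (map_mx f d) *m U.
Proof.
move=> UV; have [uU _] := mulmx1_unit UV.
have iU : invmx U = adjmx U.
  by rewrite -[LHS]mulmx1 -UV mulmxA mulVmx // mul1mx.
have hA := herm_diagonalized U d.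
have E : adjmx U *m rdiag d *m U = invmx U *m rdiag d *m U by rewrite iU.
have := funcalc_diag f hA uU E; rewrite iU => ->.
have D : map_mx (fun x => (f x)%:C) d = map_mx (fun x : R => x%:C) (map_mx f d).
  by apply/rowP => i; rewrite !mxE.
exact: (congr1 (fun D => adjmx U *m diag_mx D *m U) D).
Qed.

Lemma herm_spectral A : A \is hermsymmx ->
  exists U d, [/\ U *m adjmx U = 1%:M, adjmx U *m U = 1%:M,
    A = adjmx U *m rdiag d *m U &
    forall f, funcalc f A = adjmx U *m rdiag (map_mx f d) *m U].
Proof.
move=> hA.
suff [U [d [UV E]]] : exists U d, U *m adjmx U = 1%:M /\
    A = adjmx U *m rdiag d *m U.
  exists U, d; split; [exact: UV|exact: mulmx1C|exact: E|move=> f].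
  by rewrite {1}E; apply: funcalc_diagonalized.
pose d := map_mx (@complex.Re R) (spectral_diag A).
exists (spectralmx A), d; split; first exact/unitarymxP/spectral_unitarymx.
have /orthomx_spectralP E := hermitian_normalmx hA.
have D : spectral_diag A = map_mx (fun x : R => x%:C) d.
  apply/rowP => i; rewrite !mxE RRe_real //.
  exact: (mxOverP (hermitian_spectral_diag_real hA)).
pose U := spectralmx A.
have D1 := congr1 (fun D => invmx U *m diag_mx D *m U) D.
have iU := invmx_unitary (spectral_unitarymx A).
have D2 := congr1 (fun V => V *m rdiag d *m U) iU.
exact (etrans E (etrans D1 D2)).
Qed.

Lemma herm_funcalc f A : A \is hermsymmx -> funcalc f A \is hermsymmx.
Proof.
by move=> /herm_spectral [U [d [_ _ _ ->]]]; apply: herm_diagonalized.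
Qed.

Lemma funcalc_unitary_conj f U A : U *m adjmx U = 1%:M ->
  A \is hermsymmx ->
  funcalc f (adjmx U *m A *m U) = adjmx U *m funcalc f A *m U.
Proof.
move=> UV /herm_spectral [V [d [VV _ E EF]]].
have E1 e : adjmx U *m (adjmx V *m rdiag e *m V) *m U =
    adjmx (V *m U) *m rdiag e *m (V *m U).
  by rewrite adjmx_mul !mulmxA.
have VU : V *m U *m adjmx (V *m U) = 1%:M.
  by rewrite adjmx_mul mulmxA -(mulmxA V) UV mulmx1.
rewrite EF {1}E; have FE := funcalc_diagonalized f d VU.
exact (etrans (congr1 (funcalc f) (E1 d))
  (etrans FE (esym (E1 (map_mx f d))))).
Qed.

Lemma funcalc_rdiag f d : funcalc f (rdiag d) = rdiag (map_mx f d).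
Proof.
have a1 : adjmx (1%:M : 'M[R[i]]_n) = 1%:M.
  by rewrite /adjmx trmx1 map_mx1.
have h1 : (1%:M : 'M[R[i]]_n) *m adjmx 1%:M = 1%:M by rewrite a1 mulmx1.
by have := funcalc_diagonalized f d h1; rewrite a1 !mul1mx !mulmx1.
Qed.

Lemma psdmxE A : psdmx A <-> A \is hermsymmx /\
  forall v : 'cV[R[i]]_n, 0 <= (adjmx v *m A *m v) ord0 ord0.
Proof. by split. Qed.

Lemma psdmx_conj p (M : 'M[R[i]]_(n, p)) A :
  psdmx A -> psdmx (adjmx M *m A *m M).
Proof.
move=> [/hermsymmxP hA /(_ _)pA]; split.
  by apply/hermsymmxP; rewrite !adjmx_mul adjmxK hA mulmxA.
move=> v; have := pA (M *m v).
by rewrite -![_ ^t*]/(adjmx _) adjmx_mul !mulmxA.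
Qed.

Lemma rdiag_form d (v : 'cV[R[i]]_n) :
  (adjmx v *m rdiag d *m v) ord0 ord0 =
  (\sum_j d ord0 j * sqmod (v j ord0))%:C.
Proof.
rewrite mxE raddf_sum; apply: eq_bigr => j _ /=.
by rewrite /rdiag mul_mx_diag !mxE rmorphM /= sqmodE -mulrA mulrCA.
Qed.

Lemma psdmx_rdiag d : (forall j, 0 <= d ord0 j) -> psdmx (rdiag d).
Proof.
move=> d0; apply/psdmxE; split; first by apply/hermsymmxP/adjmx_rdiag.
move=> v; rewrite rdiag_form ler0c sumr_ge0 // => j _.
by rewrite mulr_ge0 ?sqmod_ge0.
Qed.

Lemma psdmx_diag_ge0 A i : psdmx A -> 0 <= A i i.
Proof.
move=> /psdmxE [_ /(_ (delta_mx i ord0))].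
rewrite /adjmx trmx_delta map_delta_mx -rowE mxE (bigD1 i) //= !mxE !eqxx mulr1.
by rewrite big1 ?addr0 // => j /negPf ji; rewrite !mxE ji mulr0.
Qed.

(** The eigenvalues are diagonal entries of the positive semidefinite matrix [U *m A *m adjmx U]. *)
Lemma psdmx_spectral A : psdmx A ->
  exists U d, [/\ U *m adjmx U = 1%:M, adjmx U *m U = 1%:M,
    A = adjmx U *m rdiag d *m U,
    forall f, funcalc f A = adjmx U *m rdiag (map_mx f d) *m U &
    forall i, 0 <= d ord0 i].
Proof.
move=> pA; have [hA _] := pA.
have [U [d [UV VU E EF]]] := herm_spectral hA.
exists U, d; split => // i.
have := psdmx_conj (adjmx U) pA.
rewrite adjmxK E !mulmxA UV mul1mx -mulmxA UV mulmx1.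
move=> /(psdmx_diag_ge0 i).
by rewrite rdiagE eqxx mulr1n ler0c.
Qed.

Lemma psdmx_funcalc f A : (forall x, 0 <= x -> 0 <= f x) -> psdmx A ->
  psdmx (funcalc f A).
Proof.
move=> f0 /psdmx_spectral [U [d [_ _ _ -> d0]]].
by apply/psdmx_conj/psdmx_rdiag => j; rewrite mxE f0.
Qed.

(** In the eigenbasis, every nonzero coordinate of [v] belongs to an eigenvalue equal to [x]. *)
Lemma funcalc_eigen f A (v : 'cV[R[i]]_n) (x : R) : A \is hermsymmx ->
  A *m v = x%:C *: v -> funcalc f A *m v = (f x)%:C *: v.
Proof.
move=> /herm_spectral [U [d [UV VU -> ->]]] E.
have {}E : rdiag d *m (U *m v) = x%:C *: (U *m v).
  have := congr1 (mulmx U) E; rewrite !mulmxA UV mul1mx.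
  by rewrite -!mulmxA linearZ.
rewrite -!mulmxA.
have -> : rdiag (map_mx f d) *m (U *m v) = (f x)%:C *: (U *m v).
  apply/colP => i; have /colP/(_ i) := E.
  rewrite /rdiag !mul_diag_mx !mxE; set w := (\sum_j _).
  have [->|w0] := eqVneq w 0; first by rewrite !mulr0.
  by move=> /(mulIf w0) /complexI ->.
by rewrite -scalemxAr mulmxA VU mul1mx.
Qed.

End Adjoint.

(** * Diagonal entries, traces and determinants of diagonalized matrices *)

Section Entries.
Variables (R : realType) (n : nat).
Implicit Types (A B U : 'M[R[i]]_n) (d : 'rV[R]_n) (f : R -> R).

Lemma mulmx_deltaE A i j : (A *m delta_mx j ord0 : 'cV_n) i ord0 = A i j.
Proof.
rewrite mxE (bigD1 j) //= mxE !eqxx mulr1 big1 ?addr0 // => k /negPf kj.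
by rewrite mxE kj mulr0.
Qed.

(** For unitary [U] the weights [sqmod (U j i)] form a doubly stochastic matrix; the next two lemmas
    give its column and row sums. *)
Lemma diagonalized_diagE U d i :
  (adjmx U *m rdiag d *m U) i i = (\sum_j d ord0 j * sqmod (U j i))%:C.
Proof.
rewrite mxE raddf_sum; apply: eq_bigr => j _ /=.
by rewrite /rdiag mul_mx_diag !mxE rmorphM /= sqmodE -mulrA mulrCA.
Qed.

Lemma sum_sqmod_col U i : adjmx U *m U = 1%:M -> \sum_j sqmod (U j i) = 1.
Proof.
move=> /matrixP/(_ i i); rewrite !mxE eqxx => E.
apply: complexI; rewrite raddf_sum /= -[RHS]E.
by apply: eq_bigr => j _; rewrite sqmodE adjmxE.
Qed.

Lemma sum_sqmod_row U j : U *m adjmx U = 1%:M -> \sum_i sqmod (U j i) = 1.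
Proof.
move=> /matrixP/(_ j j); rewrite !mxE eqxx => E.
apply: complexI; rewrite raddf_sum /= -[RHS]E.
by apply: eq_bigr => i _; rewrite sqmodE adjmxE mulrC.
Qed.

Lemma diagonalized_trace U d : U *m adjmx U = 1%:M ->
  \sum_i complex.Re ((adjmx U *m rdiag d *m U) i i) = \sum_j d ord0 j.
Proof.
move=> UV; under eq_bigr do rewrite diagonalized_diagE.
rewrite exchange_big /=; apply: eq_bigr => j _.
by rewrite -mulr_sumr sum_sqmod_row ?mulr1.
Qed.

Lemma diagonalized_det U d : adjmx U *m U = 1%:M ->
  \det (adjmx U *m rdiag d *m U) = (\prod_j d ord0 j)%:C.
Proof.
move=> VU; rewrite !det_mulmx mulrAC -det_mulmx VU det1 mul1r det_diag.
by rewrite rmorph_prod; apply: eq_bigr => j _; rewrite mxE.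
Qed.

(** This is A^(1/2) B A^(1/2) for A = [rdiag d]. *)
Definition sandwich d B : 'M[R[i]]_n :=
  rdiag (map_mx Num.sqrt d) *m B *m rdiag (map_mx Num.sqrt d).

Lemma psdmx_sandwich d B : psdmx B -> psdmx (sandwich d B).
Proof.
by move=> /(psdmx_conj (rdiag (map_mx Num.sqrt d))); rewrite adjmx_rdiag.
Qed.

Lemma sandwichE d B i j :
  sandwich d B i j = (Num.sqrt (d ord0 i) * Num.sqrt (d ord0 j))%:C * B i j.
Proof.
by rewrite /sandwich /rdiag mul_mx_diag mul_diag_mx !mxE rmorphM /= mulrAC.
Qed.

Lemma sandwich_diagE d B i : 0 <= d ord0 i ->
  sandwich d B i i = (d ord0 i)%:C * B i i.
Proof. by move=> d0; rewrite sandwichE -expr2 sqr_sqrtr. Qed.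

Lemma det_sandwich d B : (forall i, 0 <= d ord0 i) ->
  \det (sandwich d B) = (\prod_i d ord0 i)%:C * \det B.
Proof.
move=> d0; rewrite /sandwich !det_mulmx mulrAC; congr (_ * _).
rewrite det_diag -big_split rmorph_prod /=.
by apply: eq_bigr => i _; rewrite !mxE -rmorphM -expr2 sqr_sqrtr.
Qed.

Lemma sandwichK d B : (forall i, 0 < d ord0 i) ->
  sandwich (map_mx (@GRing.inv R) d) (sandwich d B) = B.
Proof.
move=> d0; apply/matrixP => i j; rewrite !sandwichE !mxE mulrA -rmorphM /=.
set q := Num.sqrt _ * _ * _; suff -> : q = 1 by rewrite mul1r.
rewrite /q mulrACA -[X in X * _]sqrtrM -?[X in _ * X]sqrtrM.
- by rewrite !mulVf ?gt_eqF // sqrtr1 mulr1.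
- by rewrite invr_ge0 ltW.
- by rewrite invr_ge0 ltW.
Qed.

End Entries.

(** * Dimension two *)

Section Dim2.
Variable R : realType.
Implicit Types (s : R) (d : 'rV[R]_2) (B : 'M[R[i]]_2) (F : 'I_2 -> R).

Lemma sum_ord2 F : \sum_i F i = F ord0 + F ord_max.
Proof.
by rewrite !big_ord_recl big_ord0 addr0; congr (_ + F _); apply/val_inj.
Qed.

Lemma prod_ord2 F : \prod_i F i = F ord0 * F ord_max.
Proof.
by rewrite !big_ord_recl big_ord0 mulr1; congr (_ * F _); apply/val_inj.
Qed.

(** The eigenvalue pair of X = [sandwich d B] has product det X, as do both ways of pairing the
    eigenvalues of A = [rdiag d] with those of B. The trace of X averages the sums of these two
    pairings, with the same weights that appear in Tr A^s B^s, so [powR_sum_convex] applies. *)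
Lemma araki_lieb_thirring2 s d B :
  1 < s -> (forall i, 0 <= d ord0 i) -> psdmx B ->
  \sum_i complex.Re (mxpowR (sandwich d B) s i i) <=
  \sum_i powR (d ord0 i) s * complex.Re (mxpowR B s i i).
Proof.
move=> s1 d0 pB.
have [U [b [UV VU BE BF b0]]] := psdmx_spectral pB.
have [W [x [WV VW XE XF x0]]] := psdmx_spectral (psdmx_sandwich d pB).
rewrite /mxpowR XF BF diagonalized_trace //.
have trX := diagonalized_trace x WV.
have := diagonalized_det x VW.
rewrite -XE in trX *; rewrite det_sandwich // BE diagonalized_det // -rmorphM.
move=> /complexI detX; move: trX.
have dg i : complex.Re (sandwich d B i i) =
    d ord0 i * \sum_j b ord0 j * sqmod (U j i).
  by rewrite sandwich_diagE // {1}BE diagonalized_diagE -rmorphM.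
have c0 := sum_sqmod_col ord0 VU; have c1 := sum_sqmod_col ord_max VU.
have r0 := sum_sqmod_row ord0 UV.
move: detX c0 c1 r0.
rewrite !(sum_ord2, prod_ord2) !dg !diagonalized_diagE !sum_ord2 /= !mxE.
have := sqmod_ge0 (U ord0 ord0); have := sqmod_ge0 (U ord_max ord0).
set u00 := sqmod (U ord0 ord0); set u10 := sqmod (U ord_max ord0).
set u01 := sqmod (U ord0 ord_max); set u11 := sqmod (U ord_max ord_max).
have := d0 ord0; have := d0 ord_max; have := b0 ord0; have := b0 ord_max.
have := x0 ord0; have := x0 ord_max.
set x1 := x _ _; set x2 := x _ _; set b1 := b _ _; set b2 := b _ _.
set d1 := d _ _; set d2 := d _ _.
move=> x10 x20 b10 b20 d10 d20 u0 u1 detX c0 c1 r0 trX.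
(* A doubly stochastic matrix of size two has a single parameter. *)
have E1 : u11 = u00 by lra.
have E2 : u01 = 1 - u00 by lra.
have E3 : u10 = 1 - u00 by lra.
have H : powR x2 s + powR x1 s <=
    u00 * (powR (d2 * b2) s + powR (d1 * b1) s) +
    (1 - u00) * (powR (d2 * b1) s + powR (d1 * b2) s).
  apply: powR_sum_convex => //; rewrite ?mulr_ge0 //.
  - by rewrite u1 /=; lra.
  - by rewrite -detX; ring.
  - by rewrite -detX; ring.
  - by rewrite -trX E1 E2 E3; ring.
rewrite !powRM // in H; rewrite E1 E2 E3; apply: (le_trans H).
by rewrite le_eqVlt; apply/orP; left; apply/eqP; ring.
Qed.

Lemma sum_ord2_neq F (i j : 'I_2) : i != j -> \sum_k F k = F i + F j.
Proof.
rewrite sum_ord2; case: i j => [[|[|//]] pi] [[|[|//]] pj] //= _.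
  by congr (F _ + F _); apply/val_inj.
by rewrite addrC; congr (F _ + F _); apply/val_inj.
Qed.

(** Add [S i] times the first inequality and [S i * S j] times the second. The terms in [x j] and
    [b j] cancel, and the positive factor [S i - S j] can be divided out. *)
Lemma le_of_two_traces (S x b : 'I_2 -> R) i j : 0 < S j -> S j < S i ->
  \sum_k x k <= \sum_k S k * b k -> \sum_k b k <= \sum_k (S k)^-1 * x k ->
  x i <= S i * b i.
Proof.
move=> S0 Sji; have ij : i != j by apply: contraTneq Sji => ->; rewrite ltxx.
rewrite !(sum_ord2_neq _ ij).
set xi := x i; set xj := x j; set bi := b i; set bj := b j.
move: S0 Sji; set T := S j; set U := S i => T0 TU H1 H2.
have U0 := lt_trans T0 TU.
have H3 : U * T * (bi + bj) <= T * xi + U * xj.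
  have := ler_wpM2l (ltW (mulr_gt0 U0 T0)) H2.
  have -> // : U * T * (U^-1 * xi + T^-1 * xj) = T * xi + U * xj.
  by field; rewrite !gt_eqF.
have : (U - T) * xi <= (U - T) * (U * bi).
  by have := ler_wpM2l (ltW U0) H1; lra.
by rewrite ler_pM2l // subr_gt0.
Qed.

(** The degenerate case of a zero lower eigenvalue, where [S j] has no inverse. *)
Lemma le_of_trace (S x b : 'I_2 -> R) i j : i != j -> S j = 0 -> x j = 0 ->
  \sum_k x k <= \sum_k S k * b k -> x i <= S i * b i.
Proof.
by move=> ij Sj xj; rewrite !(sum_ord2_neq _ ij) Sj xj mul0r !addr0.
Qed.

(* The Araki-Lieb-Thirring inequality is applied to [(d, B)] and, with the
   roles of the two sides exchanged, to [(d^-1, sandwich d B)]; eliminating the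
   lower entries between the two gives the bound on the upper entry. *)
Lemma sandwich_pow_top s d B (i j : 'I_2) : 1 < s ->
  (forall k, 0 <= d ord0 k) -> psdmx B -> d ord0 j < d ord0 i ->
  complex.Re (mxpowR (sandwich d B) s i i) <=
  powR (d ord0 i) s * complex.Re (mxpowR B s i i).
Proof.
move=> s1 d0 pB dji; have s0 : 0 < s by lra.
have ij : i != j by apply: contraTneq dji => ->; rewrite ltxx.
have pX := psdmx_sandwich d pB.
have Hd := araki_lieb_thirring2 s1 d0 pB.
pose S k := powR (d ord0 k) s.
pose x k := complex.Re (mxpowR (sandwich d B) s k k).
pose b k := complex.Re (mxpowR B s k k).
(* If the lower eigenvalue of A is 0, the basis vector [v] lies in the kernel of X, so the entry
   (X^s)_jj is 0. *)
have := d0 j; rewrite le_eqVlt => /predU1P[dj|dj].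
  have hX : sandwich d B \is hermsymmx by case: pX.
  pose v : 'cV[R[i]]_2 := delta_mx j ord0.
  have X0 : sandwich d B *m v = (0 : R)%:C *: v.
    apply/colP => k; rewrite mulmx_deltaE [RHS]mxE sandwichE.
    by rewrite -dj sqrtr0 mulr0 rmorph0 !mul0r.
  have := funcalc_eigen (fun x => powR x s) hX X0.
  move=> /(congr1 (fun v : 'cV[R[i]]_2 => v j ord0)) /=.
  rewrite mulmx_deltaE [in RHS]mxE powR0 ?gt_eqF // rmorph0 mul0r => E.
  have xj : x j = 0 by rewrite /x /mxpowR E.
  have Sj : S j = 0 by rewrite /S -dj powR0 ?gt_eqF.
  exact: (@le_of_trace S x b i j).
have dk k : 0 < d ord0 k.
  have /orP[/eqP->|/eqP->//] : (k == i) || (k == j).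
    move: ij; rewrite -!val_eqE /=.
    by case: i j k {dji Hd dj} => [[|[|//]] pi] [[|[|//]] pj] [[|[|//]] pk].
  exact: lt_trans dji.
pose e : 'rV[R]_2 := map_mx (@GRing.inv R) d.
have e0 k : 0 <= e ord0 k by rewrite mxE invr_ge0 ltW.
have He := araki_lieb_thirring2 s1 e0 pX; rewrite sandwichK // in He.
have {}He : \sum_k b k <= \sum_k (S k)^-1 * x k.
  apply: (le_trans He); apply: ler_sum => k _.
  by rewrite /S mxE -powR_inv1 ?(ltW (dk _)) // -powRrM mulN1r powRN.
have Sj : 0 < S j by rewrite powR_gt0.
have Si : S j < S i by rewrite gt0_ltr_powR ?nnegrE ?(ltW (dk _)).
exact: le_of_two_traces Sj Si Hd He.
Qed.

(** The smaller weight multiplies the inequality of sums, and the difference of the weights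
    multiplies the inequality at the index of larger weight. *)
Lemma le_of_weights F (y z : 'I_2 -> R) : (forall k, 0 <= F k) ->
  \sum_k y k <= \sum_k z k -> (forall i j, F j < F i -> y i <= z i) ->
  \sum_k F k * y k <= \sum_k F k * z k.
Proof.
move=> F0 + H; have := H ord0 ord_max; have := H ord_max ord0.
rewrite !sum_ord2 => H1 H0 {}H.
case: (ltgtP (F ord0) (F ord_max)) => [F01|F01|->].
- have f : 0 <= F ord_max - F ord0 by rewrite subr_ge0 ltW.
  by have := ler_wpM2l f (H1 F01); have := ler_wpM2l (F0 ord0) H; lra.
- have f : 0 <= F ord0 - F ord_max by rewrite subr_ge0 ltW.
  by have := ler_wpM2l f (H0 F01); have := ler_wpM2l (F0 ord_max) H; lra.
- by have := ler_wpM2l (F0 ord_max) H; lra.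
Qed.

Lemma weighted_sandwich_le s d B F : 1 < s ->
  (forall k, 0 <= d ord0 k) -> psdmx B -> (forall k, 0 <= F k) ->
  (forall k l, d ord0 k <= d ord0 l -> F k <= F l) ->
  \sum_k F k * complex.Re (mxpowR (sandwich d B) s k k) <=
  \sum_k F k * (powR (d ord0 k) s * complex.Re (mxpowR B s k k)).
Proof.
move=> s1 d0 pB F0 Fd.
apply: le_of_weights F0 (araki_lieb_thirring2 s1 d0 pB) _ => i j Fji.
apply: sandwich_pow_top s1 d0 pB _.
by apply: contraTT Fji; rewrite -!leNgt; apply: Fd.
Qed.

End Dim2.

(** * Reduction to a diagonal A *)

Section Reduction.
Variables (R : realType) (n : nat).
Implicit Types (A B M U : 'M[R[i]]_n) (d : 'rV[R]_n) (f : R -> R).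

Lemma herm_diag_real M i : M \is hermsymmx -> M i i = (complex.Re (M i i))%:C.
Proof.
move=> /hermsymmxP/matrixP/(_ i i); rewrite adjmxE.
case: (M i i) => a b [] /eqP; rewrite -subr_eq0 -opprD oppr_eq0 -mulr2n.
by rewrite mulrn_eq0 /= => /eqP ->.
Qed.

Lemma mxtrace_rdiag d M : M \is hermsymmx ->
  \tr (rdiag d *m M) = (\sum_i d ord0 i * complex.Re (M i i))%:C.
Proof.
move=> hM; rewrite raddf_sum; apply: eq_bigr => i _ /=.
by rewrite /rdiag mul_diag_mx !mxE rmorphM /= -herm_diag_real.
Qed.

Lemma mulmx_diagonalized U d (e : 'rV[R]_n) : U *m adjmx U = 1%:M ->
  (adjmx U *m rdiag d *m U) *m (adjmx U *m rdiag e *m U) =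
  adjmx U *m rdiag (\row_i (d ord0 i * e ord0 i)) *m U.
Proof.
by move=> UV; rewrite !mulmxA -(mulmxA (adjmx U *m _)) UV mulmx1
  -(mulmxA (adjmx U)) rdiag_mul.
Qed.

Lemma psdmx_pow s M : psdmx M -> psdmx (mxpowR M s).
Proof. by apply: psdmx_funcalc => x _; apply: powR_ge0. Qed.

(** Row [i] of [U] is a left eigenvector, the kind that [eigenvalue] refers to. *)
Lemma diagonalized_eigenvalue U d i : U *m adjmx U = 1%:M ->
  eigenvalue (adjmx U *m rdiag d *m U) (d ord0 i)%:C.
Proof.
move=> UV; apply/eigenvalueP; exists (row i U).
  rewrite -row_mul !mulmxA UV mul1mx; apply/rowP => j.
  by rewrite /rdiag [LHS]mxE mul_diag_mx !mxE.
apply/eqP => r0; have : (row i U *m adjmx U) ord0 i = 0.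
  by rewrite r0 mul0mx mxE.
by rewrite -row_mul UV !mxE eqxx => /eqP; rewrite oner_eq0.
Qed.

(** With [B'] the matrix of B in an eigenbasis of A, cyclicity of the trace removes the unitary, and
    only diagonal entries of powers remain. *)
Lemma trace_reduction A B : psdmx A -> psdmx B ->
  exists d B', [/\ psdmx B', forall i, 0 <= d ord0 i,
    forall i, eigenvalue A (d ord0 i)%:C,
    forall s f, trace_split s f A B = (\sum_i f (d ord0 i) *
      (powR (d ord0 i) s * complex.Re (mxpowR B' s i i)))%:C &
    forall s f, trace_joint s f A B = (\sum_i f (d ord0 i) *
      complex.Re (mxpowR (sandwich d B') s i i))%:C].
Proof.
move=> /psdmx_spectral [U [d [UV VU EA FA d0]]] pB.
have pB' := psdmx_conj (adjmx U) pB; rewrite adjmxK in pB'.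
have UVa : adjmx U *m adjmx (adjmx U) = 1%:M by rewrite adjmxK.
have [hB _] := pB; have [hB' _] := pB'.
exists d, (U *m B *m adjmx U); split => //.
- by move=> i; rewrite EA; apply: diagonalized_eigenvalue.
- move=> s f; have := funcalc_unitary_conj (fun x => powR x s) UVa hB.
  rewrite adjmxK /trace_split /mxpowR !FA (mulmx_diagonalized _ _ UV).
  have := herm_funcalc (fun x => powR x s) hB'.
  move: (funcalc _ B) (funcalc _ (U *m B *m adjmx U)) => Bs Bs' hs E.
  rewrite -!mulmxA mxtrace_mulC -!mulmxA (mulmxA U) -E mxtrace_rdiag //.
  by congr (_%:C); apply: eq_bigr => i _; rewrite !mxE -mulrA.
- move=> s f; have EX : mxpowR A 2^-1 *m B *m mxpowR A 2^-1 =
      adjmx U *m sandwich d (U *m B *m adjmx U) *m U.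
    rewrite /mxpowR FA /sandwich.
    have -> : map_mx (fun x => powR x 2^-1) d = map_mx Num.sqrt d.
      by apply/rowP => i; rewrite !mxE powR12_sqrt.
    by rewrite !mulmxA.
  have pX := psdmx_sandwich d pB'; have [hX _] := pX.
  have := funcalc_unitary_conj (fun x => powR x s) UV hX.
  rewrite /trace_joint EX /mxpowR FA => ->.
  have := herm_funcalc (fun x => powR x s) hX.
  move: (funcalc _ (sandwich _ _)) => Xs hs.
  rewrite -!mulmxA (mulmxA U) UV mul1mx.
  rewrite mxtrace_mulC -!mulmxA UV mulmx1 mxtrace_rdiag //.
  by congr (_%:C); apply: eq_bigr => i _; rewrite !mxE.
Qed.

End Reduction.

(** Matrices of size one are numbers, and powers of nonnegative numbers are multiplicative. *)
Lemma sandwich_pow_dim1 (R : realType) s (d : 'rV[R]_1) (B : 'M[R[i]]_1) i :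
  0 <= d ord0 i -> psdmx B ->
  complex.Re (mxpowR (sandwich d B) s i i) =
  powR (d ord0 i) s * complex.Re (mxpowR B s i i).
Proof.
move=> d0 pB; have [hB _] := pB.
have B0 := psdmx_diag_ge0 i pB.
pose b : 'rV[R]_1 := const_mx (complex.Re (B i i)).
have {}B0 : 0 <= complex.Re (B i i) by move: B0; rewrite lecE => /andP[].
have BE : B = rdiag b.
  apply/matrixP => j k; rewrite (ord1 j) (ord1 k) rdiagE mxE eqxx mulr1n.
  by rewrite /b (ord1 i) -herm_diag_real.
have XE : sandwich d B = rdiag (const_mx (d ord0 i * complex.Re (B i i))).
  apply/matrixP => j k; rewrite (ord1 j) (ord1 k) -(ord1 i).
  rewrite sandwich_diagE // rdiagE mxE eqxx mulr1n rmorphM /=.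
  by rewrite -herm_diag_real.
have powE c : mxpowR (rdiag (const_mx c : 'rV[R]_1)) s i i = (powR c s)%:C.
  by rewrite /mxpowR funcalc_rdiag rdiagE !mxE eqxx.
by rewrite XE {2}BE !powE powRM.
Qed.

Lemma dim_le2_trace_le (R : realType) (s : R) n (A B : 'M[R[i]]_n)
    (I : interval R) (f : R -> R) :
  1 < s -> (0 < n < 3)%N -> psdmx A -> psdmx B -> spec_in A I ->
  nonneg_nondecr_on I f -> trace_joint s f A B <= trace_split s f A B.
Proof.
move=> s1 n12 pA pB sA [f0 fI].
have [d [B' [pB' d0 dA -> ->]]] := trace_reduction pA pB.
have dI i : d ord0 i \in I.
  by have [x /= xI [<-]] := sA _ (dA i).
rewrite lecR; case: n n12 A B pA pB sA d B' pB' d0 dA dI => [|[|[|//]]] // _.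
  move=> A B _ _ _ d B' pB' d0 _ dI.
  rewrite le_eqVlt; apply/orP; left; apply/eqP; apply: eq_bigr => i _.
  by rewrite sandwich_pow_dim1.
move=> A B _ _ _ d B' pB' d0 _ dI.
apply: (@weighted_sandwich_le R s d B' (fun k => f (d ord0 k))) => // k.
  exact: f0.
by move=> l; apply: fI.
Qed.

(** * Dimension three *)

Section EigenBound.
Variables (R : realType) (n : nat).
Implicit Types (A B P Q : 'M[R[i]]_n) (d : 'rV[R]_n) (v : 'cV[R[i]]_n).

Lemma adjmxZ m p (c : R) (M : 'M[R[i]]_(m, p)) :
  adjmx (c%:C *: M) = c%:C *: adjmx M.
Proof.
apply/matrixP => i j; rewrite [RHS]mxE !adjmxE mxE.
by rewrite (rmorphM conjc); congr (_ * _); exact: conjc_real.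
Qed.

Lemma adjmxB m p (M N : 'M[R[i]]_(m, p)) : adjmx (M - N) = adjmx M - adjmx N.
Proof. by rewrite /adjmx linearB map_mxB. Qed.

Lemma adjmx_sqmod v :
  (adjmx v *m v) ord0 ord0 = (\sum_j sqmod (v j ord0))%:C.
Proof.
rewrite mxE raddf_sum; apply: eq_bigr => j _ /=.
by rewrite adjmxE sqmodE.
Qed.

(** The products [P *m v] and [adjmx v *m P] are kept together so that the eigenvector equation and
    its adjoint can be substituted. *)
Lemma form_shift P v (e : 'cV[R[i]]_n) (t : R) :
  (adjmx (e - t%:C *: v) *m P *m (e - t%:C *: v)) ord0 ord0 =
  (adjmx e *m P *m e) ord0 ord0 - t%:C * (adjmx e *m (P *m v)) ord0 ord0
  - t%:C * ((adjmx v *m P *m e) ord0 ord0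
            - t%:C * (adjmx v *m (P *m v)) ord0 ord0).
Proof.
rewrite adjmxB adjmxZ !mulmxBl !mulmxBr -!scalemxAl -!scalemxAr -!mulmxA.
move: (adjmx e *m (P *m e)) (adjmx e *m (P *m v)) => X1 X2.
move: (adjmx v *m (P *m e)) (adjmx v *m (P *m v)) => X3 X4.
by rewrite !mxE; ring.
Qed.

(* Positivity of [P] at [e_i - t v], for the optimal [t = 1 / |v|^2]. *)
Lemma psdmx_diag_ge_eigen P v (c N : R) i : psdmx P -> P *m v = c%:C *: v ->
  v i ord0 = 1 -> N = \sum_j sqmod (v j ord0) -> c / N <= complex.Re (P i i).
Proof.
move=> /psdmxE [hP pP] Pv vi NE.
have N0 : 0 < N.
  rewrite NE (bigD1 i) //= vi ltr_wpDr ?sumr_ge0 // => [j _|].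
    exact: sqmod_ge0.
  by rewrite /sqmod /= expr1n expr0n addr0.
pose e : 'cV[R[i]]_n := delta_mx i ord0.
have vP : adjmx v *m P = c%:C *: adjmx v.
  have := congr1 (@adjmx R n 1) Pv; rewrite adjmx_mul.
  by have /hermsymmxP -> := hP => ->; rewrite adjmxZ.
have evi : (adjmx e *m v) ord0 ord0 = 1.
  rewrite mxE (bigD1 i) //= adjmxE mxE !eqxx conjc1 vi mul1r big1 ?addr0 //.
  by move=> j /negPf ji; rewrite adjmxE mxE ji conjc0 mul0r.
have vei : (adjmx v *m e) ord0 ord0 = 1.
  have : adjmx (adjmx e *m v) ord0 ord0 = 1 by rewrite adjmxE evi conjc1.
  by rewrite adjmx_mul adjmxK.
have ePe : (adjmx e *m P *m e) ord0 ord0 = (complex.Re (P i i))%:C.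
  rewrite -mulmxA mxE (bigD1 i) //= adjmxE mxE !eqxx conjc1 mul1r big1.
    by rewrite addr0 mulmx_deltaE herm_diag_real.
  by move=> j /negPf ji; rewrite adjmxE mxE ji conjc0 mul0r.
pose t : R := N^-1.
have := pP (e - t%:C *: v); rewrite form_shift Pv vP ePe.
have -> : (adjmx e *m (c%:C *: v)) ord0 ord0 = c%:C.
  by rewrite -scalemxAr mxE evi mulr1.
have -> : (adjmx v *m (c%:C *: v)) ord0 ord0 = (c * N)%:C.
  by rewrite -scalemxAr mxE adjmx_sqmod -NE rmorphM.
have -> : (c%:C *: adjmx v *m e) ord0 ord0 = c%:C.
  by rewrite -scalemxAl mxE vei mulr1.
rewrite -!(rmorphM, rmorphB) ler0c => H.
(* For [t = 1 / N] the form is P_ii - 2 t c + t^2 c N = P_ii - c / N. *)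
rewrite -subr_ge0; apply: (le_trans H).
rewrite le_eqVlt; apply/orP; left; apply/eqP.
by rewrite /t; field; rewrite gt_eqF.
Qed.

End EigenBound.

(** * Matrices given by an explicit diagonalization *)

Section Diagonalized.
Variables (R : realType) (n : nat).
Implicit Types (A B P Q : 'M[R[i]]_n) (d w m : 'rV[R]_n) (f : R -> R).

(** Here the rows of [Q] are orthogonal but not normalized, and [w] holds their inverse squared
    lengths. This keeps square roots out of the explicit matrices. *)
Lemma funcalc_orthogonal_rows f Q w m : Q *m (adjmx Q *m rdiag w) = 1%:M ->
  funcalc f (adjmx Q *m rdiag (\row_i (w ord0 i * m ord0 i)) *m Q) =
  adjmx Q *m rdiag (\row_i (w ord0 i * f (m ord0 i))) *m Q.
Proof.
move=> Qw; have [uQ _] := mulmx1_unit Qw.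
have iQ : adjmx Q *m rdiag w = invmx Q.
  by have := congr1 (mulmx (invmx Q)) Qw; rewrite mulKmx // mulmx1.
have E (e : 'rV[R]_n) : adjmx Q *m rdiag (\row_i (w ord0 i * e ord0 i)) *m Q =
    invmx Q *m rdiag e *m Q by rewrite -rdiag_mul mulmxA iQ.
have hA := herm_diagonalized Q (\row_i (w ord0 i * m ord0 i)).
have := funcalc_diag f hA uQ (E m) => ->.
have D : map_mx (fun x => (f x)%:C) m = map_mx (fun x : R => x%:C) (map_mx f m).
  by apply/rowP => i; rewrite !mxE.
have D1 := congr1 (fun D => invmx Q *m diag_mx D *m Q) D.
apply: (etrans D1); rewrite -/(rdiag _) -E.
congr (_ *m rdiag _ *m _).
by apply/rowP => i; rewrite !mxE.
Qed.

Lemma pdmx_diagonalized Q d : Q \in unitmx -> (forall i, 0 < d ord0 i) ->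
  pdmx (adjmx Q *m rdiag d *m Q).
Proof.
move=> uQ d0; split; first exact: herm_diagonalized.
move=> v v0; suff: 0 < (adjmx (Q *m v) *m rdiag d *m (Q *m v)) ord0 ord0.
  by rewrite adjmx_mul !mulmxA.
have Qv0 : Q *m v != 0.
  by apply: contraNneq v0 => Qv; rewrite -[v](mulKmx uQ) Qv mulmx0.
have /existsP[j vj] : [exists j, (Q *m v) j ord0 != 0].
  apply: contraNT Qv0; rewrite negb_exists => /forallP h.
  by apply/eqP/colP => j; have := h j; rewrite negbK [RHS]mxE => /eqP.
rewrite rdiag_form ltcR (bigD1 j) //= ltr_pwDl //; last first.
  by apply: sumr_ge0 => k _; rewrite mulr_ge0 ?sqmod_ge0 // ltW.
rewrite mulr_gt0 // lt_neqAle sqmod_ge0 andbT eq_sym.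
by rewrite -(inj_eq (@complexI R)) sqmodE mulf_neq0 // conjc_eq0.
Qed.

Lemma pdmx_rdiag d : (forall i, 0 < d ord0 i) -> pdmx (rdiag d).
Proof.
move=> d0; have a1 : adjmx (1%:M : 'M[R[i]]_n) = 1%:M.
  by rewrite /adjmx trmx1 map_mx1.
by have := pdmx_diagonalized (unitmx1 _ _) d0; rewrite a1 mul1mx mulmx1.
Qed.

Lemma pdmx_psdmx A : pdmx A -> psdmx A.
Proof.
move=> [hA pA]; split=> // v; have [->|/pA/ltW//] := eqVneq v 0.
by rewrite mulmx0 mxE.
Qed.

Definition rcol (y : 'I_n -> R) : 'cV[R[i]]_n := \col_i (y i)%:C.

(** With D = [rdiag d] and v = D^(-1/2) y, one has X v = D^(1/2) B y = D^(1/2) g, which equals l v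
    because D g = l y. *)
Lemma sandwich_eigen d B (l : R) (y g : 'I_n -> R) : (forall i, 0 < d ord0 i) ->
  B *m rcol y = rcol g -> (forall i, d ord0 i * g i = l * y i) ->
  sandwich d B *m rcol (fun i => y i / Num.sqrt (d ord0 i)) =
  l%:C *: rcol (fun i => y i / Num.sqrt (d ord0 i)).
Proof.
move=> d0 By dg.
have s0 i : Num.sqrt (d ord0 i) != 0 by rewrite gt_eqF ?sqrtr_gt0.
pose e : 'rV[R]_n := map_mx (fun x => (Num.sqrt x)^-1) d.
have v : rcol (fun i => y i / Num.sqrt (d ord0 i)) = rdiag e *m rcol y.
  apply/colP => i; rewrite /rdiag mul_diag_mx !mxE -rmorphM.
  by rewrite mulrC.
have de : rdiag (map_mx Num.sqrt d) *m rdiag e = 1%:M.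
  by apply/matrixP => i j; rewrite rdiag_mul rdiagE !mxE mulfV.
rewrite {1}v /sandwich !mulmxA -(mulmxA _ _ (rdiag e)) de mulmx1.
rewrite -mulmxA By; apply/colP => i.
rewrite /rdiag mul_diag_mx !mxE -!rmorphM; congr (_%:C).
rewrite mulrA -dg mulrAC; congr (_ * _).
by rewrite -[X in X / _](@sqr_sqrtr _ (d ord0 i)) ?ltW // expr2 mulfK.
Qed.

Lemma spec_in_rdiag d : spec_in (rdiag d) `]-oo, +oo[.
Proof.
move=> a /eigenvalueP [v vA v0].
have /existsP[j vj] : [exists j, v ord0 j != 0].
  apply: contraNT v0; rewrite negb_exists => /forallP h.
  by apply/eqP/rowP => j; have := h j; rewrite negbK [RHS]mxE => /eqP.
exists (d ord0 j) => //; have /rowP/(_ j) := vA.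
by rewrite /rdiag mul_mx_diag !mxE mulrC => /(mulIf vj).
Qed.

Lemma trace_split_rdiag s f d B : B \is hermsymmx ->
  trace_split s f (rdiag d) B = (\sum_i f (d ord0 i) *
    (powR (d ord0 i) s * complex.Re (mxpowR B s i i)))%:C.
Proof.
move=> hB; have := herm_funcalc (fun x => powR x s) hB.
rewrite /trace_split /mxpowR !funcalc_rdiag; move: (funcalc _ B) => Bs hs.
rewrite rdiag_mul mxtrace_rdiag //; congr (_%:C).
by apply: eq_bigr => i _; rewrite !mxE mulrA.
Qed.

Lemma trace_joint_rdiag s f d B : (forall i, 0 <= d ord0 i) -> psdmx B ->
  trace_joint s f (rdiag d) B =
  (\sum_i f (d ord0 i) * complex.Re (mxpowR (sandwich d B) s i i))%:C.
Proof.
move=> d0 pB; have [hX _] := psdmx_sandwich d pB.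
have := herm_funcalc (fun x => powR x s) hX.
have dE : map_mx (fun x => powR x 2^-1) d = map_mx Num.sqrt d.
  by apply/rowP => i; rewrite !mxE powR12_sqrt.
rewrite /trace_joint {2 3}/mxpowR !funcalc_rdiag dE -/(sandwich d B) /mxpowR.
move: (funcalc _ (sandwich _ _)) => Xs hs.
rewrite mxtrace_rdiag //; congr (_%:C).
by apply: eq_bigr => i _; rewrite !mxE.
Qed.

End Diagonalized.

(** * The matrices of the counterexample *)

Section Counterexample.
Variables (R : realType) (s : R).

Definition row3 (a b c : R) : 'rV[R]_3 := \row_i nth 0 [:: a; b; c] i.

(* The rows are orthogonal eigenvectors of [cexB] for its eigenvalues [M], [3]
   and [1]; [cexW] holds their inverse squared lengths. *)
Definition cexQ_entry (i j : nat) : R :=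
  nth 0 (nth [::] [:: [:: 0; 3; 4]; [:: 5; 4; -3]; [:: 5; -4; 3]] i) j.

Definition cexQ : 'M[R[i]]_3 := \matrix_(i, j) (cexQ_entry i j)%:C.

Definition cexW : 'rV[R]_3 := row3 25^-1 50^-1 50^-1.

Lemma cexQ_adjE i j : adjmx cexQ i j = (cexQ_entry j i)%:C.
Proof. by rewrite adjmxE mxE conjc_real. Qed.

Lemma cexQE : cexQ *m (adjmx cexQ *m rdiag cexW) = 1%:M.
Proof.
have real_entry i j : (cexQ *m adjmx cexQ) i j =
    (\sum_(k < 3) cexQ_entry i k * cexQ_entry j k)%:C.
  rewrite mxE raddf_sum; apply: eq_bigr => k _.
  by rewrite cexQ_adjE mxE [RHS]rmorphM.
rewrite mulmxA; apply/matrixP => i j.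
rewrite /rdiag mul_mx_diag mxE real_entry !mxE -rmorphM /=.
rewrite -[RHS](@rmorph_nat _ _ (real_complex R)); congr (_%:C).
rewrite !big_ord_recl big_ord0.
by case: i => [[|[|[|//]]] pi]; case: j => [[|[|[|//]]] pj];
  rewrite /cexQ_entry /= ?eqxx /=; field.
Qed.

Variables (Y : R).
Hypothesis Y1 : 1 <= Y.

(** The coordinates of [cexB] applied to (1, 5 Y, 5) are [l], [g2] and [g3]; the first does not
    involve [M]. The choice M = 3 l is large enough to put the lower entries of [cexd] below 1, yet
    keeps [g2 / l] and [g3 / l] of order Y. *)
Let l : R := 4 * Y - 1.
Let M : R := 3 * l.
Let g2 : R := (9 * M * Y + 12 * M + 32 * Y - 20) / 5.
Let g3 : R := (12 * M * Y + 16 * M - 24 * Y + 15) / 5.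

Definition cexB : 'M[R[i]]_3 := adjmx cexQ *m
  rdiag (\row_i (cexW ord0 i * row3 M 3 1 ord0 i)) *m cexQ.

Definition cexd : 'rV[R]_3 := row3 1 (l * (5 * Y) / g2) (l * 5 / g3).

(* [cexB] maps [y] to [g], and [cexd] is chosen so that [cexd_i g_i = l y_i];
   hence [(y_i / sqrt cexd_i)_i] is an eigenvector of [sandwich cexd cexB]. *)
Let y (i : 'I_3) : R := row3 1 (5 * Y) 5 ord0 i.
Let g (i : 'I_3) : R := row3 l g2 g3 ord0 i.

Lemma cexB_eigen : cexB *m rcol y = rcol g.
Proof.
have E1 : cexQ *m rcol y =
    rcol (row3 (15 * Y + 20) (20 * Y - 10) (20 - 20 * Y) ord0).
  apply/colP => i; rewrite !mxE.
  under eq_bigr do rewrite !mxE -rmorphM.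
  rewrite -raddf_sum /=; congr (_%:C); rewrite !big_ord_recl big_ord0.
  by case: i => [[|[|[|//]]] pi]; rewrite /cexQ_entry /y !mxE /=; ring.
rewrite /cexB -mulmxA E1 -mulmxA; apply/colP => i.
rewrite mxE [RHS]mxE.
under eq_bigr do rewrite cexQ_adjE /rdiag mul_diag_mx !mxE -!rmorphM.
rewrite -raddf_sum /=; congr (_%:C); rewrite !big_ord_recl big_ord0.
rewrite /cexQ_entry /g /g2 /g3 /M /l.
by case: i => [[|[|[|//]]] pi]; rewrite !mxE /=; field.
Qed.

(** The top eigenvector of [cexB] has first coordinate 0, so [M] drops out; the eigenvalues 3 and 1
    get weight 25 / 50 each. *)
Lemma cexB_pow : complex.Re (mxpowR cexB s ord0 ord0) = (powR 3 s + 1) / 2.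
Proof.
rewrite /mxpowR (funcalc_orthogonal_rows _ _ cexQE) diagonalized_diagE /=.
by rewrite !big_ord_recl big_ord0 /sqmod !mxE /cexQ_entry /= powR1; field.
Qed.

Let l3 : 3 * Y <= l. Proof. by have := Y1; rewrite /l => h; lra. Qed.

Let g2_bound : l * (5 * Y) < g2.
Proof. by have := l3; have := Y1; rewrite /g2 /M; nra. Qed.

Let g3_bound : l * 5 < g3.
Proof. by have := l3; have := Y1; rewrite /g3 /M; nra. Qed.

Let l_gt0 : 0 < l.
Proof. by have := l3; have := Y1; lra. Qed.

Let g2_gt0 : 0 < g2.
Proof. by apply: lt_trans g2_bound; have := l_gt0; have := Y1; nra. Qed.

Let g3_gt0 : 0 < g3.
Proof. by apply: lt_trans g3_bound; rewrite mulr_gt0 ?l_gt0. Qed.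

Lemma cexd_gt0 i : 0 < cexd ord0 i.
Proof.
have Y0 : 0 < Y by have := Y1; lra.
rewrite mxE; case: i => [[|[|[|//]]] pi] //=.
  by rewrite divr_gt0 ?g2_gt0 // !mulr_gt0 ?l_gt0.
by rewrite divr_gt0 ?g3_gt0 // mulr_gt0 ?l_gt0.
Qed.

Lemma cexd_lt1 (i : 'I_3) : (0 < i)%N -> cexd ord0 i < 1.
Proof.
rewrite mxE; case: i => [[|[|[|//]]] pi] //= _.
  by rewrite ltr_pdivrMr ?g2_gt0 // mul1r g2_bound.
by rewrite ltr_pdivrMr ?g3_gt0 // mul1r g3_bound.
Qed.

Lemma cexB_pd : pdmx cexB.
Proof.
have [uQ _] := mulmx1_unit cexQE; apply: pdmx_diagonalized uQ _ => i.
have M0 : 0 < M by rewrite mulr_gt0 ?l_gt0.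
by rewrite !mxE; case: i => [[|[|[|//]]] pi] /=; rewrite mulr_gt0 ?invr_gt0.
Qed.

(** [psdmx_diag_ge_eigen] for X^s and its eigenvector v = (y_i / sqrt d_i), with eigenvalue l^s and
    first coordinate 1. The squared norm of v is 1 + 5 Y g2 / l + 5 g3 / l, crudely bounded by 200
    Y^2. *)
Lemma cexX_pow : powR l s / (200 * Y ^+ 2) <
  complex.Re (mxpowR (sandwich cexd cexB) s ord0 ord0).
Proof.
have pX := psdmx_sandwich cexd (pdmx_psdmx cexB_pd); have [hX _] := pX.
have dg i : cexd ord0 i * g i = l * y i.
  rewrite /g /y !mxE; case: i => [[|[|[|//]]] pi] /=; first by rewrite mulrC.
    by rewrite divfK ?gt_eqF ?g2_gt0.
  by rewrite divfK ?gt_eqF ?g3_gt0.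
have Xv := sandwich_eigen cexd_gt0 cexB_eigen dg.
have Pv := funcalc_eigen (fun x => powR x s) hX Xv.
have pP := psdmx_pow s pX.
set v := rcol _ in Pv.
have v1 : v ord0 ord0 = 1 by rewrite /v !mxE /y mxE /= sqrtr1 divr1.
apply: lt_le_trans (psdmx_diag_ge_eigen pP Pv v1 erefl).
rewrite ltr_pM2l ?powR_gt0 ?l_gt0 //.
have vE i : sqmod (v i ord0) = y i ^+ 2 / cexd ord0 i.
  rewrite /v mxE /sqmod /= expr0n addr0 expr_div_n sqr_sqrtr // ltW //.
  exact: cexd_gt0.
under eq_bigr do rewrite vE.
have Y0 : 0 < Y by have := Y1; lra.
have -> : \sum_i y i ^+ 2 / cexd ord0 i = 1 + 5 * Y * g2 / l + 5 * g3 / l.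
  rewrite !big_ord_recl big_ord0 /y !mxE /=; field.
  by rewrite !gt_eqF ?l_gt0 ?g2_gt0 ?g3_gt0.
rewrite ltf_pV2 ?posrE ?mulr_gt0 ?exprn_gt0 //; last first.
  have h2 : 0 < 5 * Y * g2 / l.
    by apply: divr_gt0 => //; rewrite mulr_gt0 // mulr_gt0.
  have h3 : 0 < 5 * g3 / l by apply: divr_gt0 => //; rewrite mulr_gt0.
  by rewrite !addr_gt0.
have l0 := l_gt0; have := l3.
rewrite -[X in X + _ + _](divff (_ : l != 0)) ?gt_eqF // -!mulrDl.
rewrite ltr_pdivrMr // /g2 /g3 /M /l; have := Y1; nra.
Qed.

End Counterexample.

Lemma sum_weight_first (R : realType) n (F x : 'I_n.+1 -> R) :
  F ord0 = 1 -> (forall i : 'I_n.+1, (0 < i)%N -> F i = 0) ->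
  \sum_i F i * x i = x ord0.
Proof.
move=> F1 F0; rewrite (bigD1 ord0) //= F1 mul1r big1 ?addr0 // => i i0.
by rewrite F0 ?mul0r // lt0n.
Qed.

Lemma dim3_counterexample (R : realType) (s : R) : 2 < s ->
  exists (A B : 'M[R[i]]_3) (I : interval R) (f : R -> R),
     [/\ pdmx A, pdmx B, spec_in A I, nonneg_nondecr_on I f &
         trace_split s f A B < trace_joint s f A B].
Proof.
(* Chosen so that Y^(s - 2) = 200, which turns the factor 200 Y^2 into exactly Y^s. *)
move=> s2; pose Y : R := powR 200 (s - 2)^-1.
have Y1 : 1 <= Y.
  have e : powR 1 (s - 2)^-1 = 1 :> R by rewrite powR1.
  rewrite -[leLHS]e ge0_ler_powR ?nnegrE ?ler1n //.
  by rewrite invr_ge0 subr_ge0 ltW.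
have Y0 : 0 < Y by lra.
have YE : powR Y s = 200 * Y ^+ 2.
  rewrite -(subrK 2 s) powRD; last by apply/implyP => _; rewrite gt_eqF.
  rewrite powR_mulrn ?(ltW Y0) //; congr (_ * _).
  by rewrite /Y -powRrM mulVf ?powRr1 // gt_eqF // subr_gt0.
(* On the spectrum of A this step function singles out the eigenvalue 1. *)
pose f (x : R) : R := if 1 <= x then 1 else 0.
have dg0 := cexd_gt0 Y1; have pB := cexB_pd Y1.
exists (rdiag (cexd Y)), (cexB Y), `]-oo, +oo[, f.
split; [exact: pdmx_rdiag|exact: pB|exact: spec_in_rdiag| |].
  split=> [x _|x z _ _ xz]; first by rewrite /f; case: ifP.
  rewrite /f; case: ifP => [x1|_]; first by rewrite (le_trans x1 xz).
  by case: ifP.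
have psB := pdmx_psdmx pB; have [hB _] := psB.
pose F i := f (cexd Y ord0 i).
have F0 (i : 'I_3) : (0 < i)%N -> F i = 0.
  by move=> i0; rewrite /F /f leNgt cexd_lt1.
have d1 : cexd Y ord0 ord0 = 1 by rewrite mxE.
have F1 : F ord0 = 1 by rewrite /F /f d1 lexx.
pose b i := powR (cexd Y ord0 i) s * complex.Re (mxpowR (cexB Y) s i i).
pose x i := complex.Re (mxpowR (sandwich (cexd Y) (cexB Y)) s i i).
have d0 i : 0 <= cexd Y ord0 i := ltW (dg0 i).
rewrite (trace_split_rdiag s f _ hB) (trace_joint_rdiag s f d0 psB) ltcR.
suff H : b ord0 < x ord0.
  by rewrite -(sum_weight_first b F1 F0) -(sum_weight_first x F1 F0) in H.
rewrite /b d1 powR1 mul1r cexB_pow.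
apply: lt_trans (cexX_pow s Y1).
have Y2 : 0 < 200 * Y ^+ 2 by rewrite mulr_gt0 ?exprn_gt0.
have p3 : 1 < powR (3 : R) s.
  have e : powR 1 s = 1 :> R by rewrite powR1.
  by rewrite -[ltLHS]e gt0_ltr_powR ?nnegrE ?ltr1n //; lra.
(* The chain is (3^s + 1) / 2 < 3^s = (3 Y)^s / (200 Y^2) <= l^s / (200 Y^2). *)
apply: (@lt_le_trans _ _ (powR 3 s)); first lra.
rewrite ler_pdivlMr // -YE -powRM ?(ltW Y0) //.
by rewrite ge0_ler_powR ?nnegrE //; lra.
Qed.

Theorem corollary4p5 (R : realType) (s : R) (hs : 2 < s) :
  (forall n : nat, (0 < n < 3)%N ->
   forall (A B : 'M[R[i]]_n) (I : interval R) (f : R -> R),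
     psdmx A -> psdmx B -> spec_in A I -> nonneg_nondecr_on I f ->
     trace_joint s f A B <= trace_split s f A B)
  /\
  (exists (A B : 'M[R[i]]_3) (I : interval R) (f : R -> R),
     [/\ pdmx A, pdmx B, spec_in A I, nonneg_nondecr_on I f &
         trace_split s f A B < trace_joint s f A B]).
Proof.
split=> [n n12 A B I f pA pB sA fI|]; last exact: dim3_counterexample.
by apply: dim_le2_trace_le sA fI => //; apply: lt_trans hs; rewrite ltr1n.
Qed.
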